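(* Let $(V,E)$ be a rooted directed tree and let $\mu=(\mu_v)_{v\in V}$ be a weight on $V$. Let $X=\ell^p(V,\mu)$, $1\leq p<+\infty$, or $X=c_0(V,\mu)$, and suppose that the backward shift $B$ is a bounded operator on $X$. Then the following assertions are equivalent: (1) $B$ is hypercyclic. (2) $B$ is weakly hypercyclic. (3) There exists a bounded subset $C$ of $X\setminus\{0\}$ such that $\mathrm{Orb}(C,B)$ is weakly dense in $X$. (4) For every $g\in X$, every open neighborhood $U$ of $g$ and every weakly open neighborhood $W$ of $g$, there exists an integer $n\geq1$ such that $B^n(U)\cap W\neq\emptyset$.
   Context: $\mathbb{N}_0=\{0,1,2,\ldots\}$, $\mathbb{K}$ is $\mathbb{R}$ or $\mathbb{C}$. Directed tree: a pair $(V,E)$ with $V$ a non-empty countable set (vertices) and $E\subset\{(u,v):u,v\in V,u\neq v\}$ (edges) such that: (i) any two distinct vertices are joined by an undirected path; (ii) there is no circuit, i.e. no sequence $v_1,\ldots,v_n$ of distinct vertices, $n\geq2$, with $(v_j,v_{j+1})\in E$ for $1\le j<n$ and $(v_n,v_1)\in E$; (iii) for each $v\in V$ there is at most one $u\in V$ with $(u,v)\in E$; if it exists it is called the parent of $v$, denoted $\mathrm{par}(v)$. A root is a vertex without parent (there is at most one); the tree is rooted if it has a root. $\mathrm{Chi}(v)=\{u\in V:\mathrm{par}(u)=v\}$. Weight on $V$: a family $\mu=(\mu_v)_{v\in V}$ of non-zero numbers in $\mathbb{K}$. $\ell^p(V,\mu)=\{f\in\mathbb{K}^V:\|f\|_{p,\mu}^p=\sum_{v}|f(v)\mu_v|^p<+\infty\}$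 with norm $\|\cdot\|_{p,\mu}$; $c_0(V,\mu)$ is the set of $f\in\mathbb{K}^V$ such that for every $\varepsilon>0$ there is a finite $F\subset V$ with $|f(v)\mu_v|<\varepsilon$ for all $v\in V\setminus F$, with norm $\sup_v|f(v)\mu_v|$. The backward shift is $(Bf)(v)=\sum_{u\in\mathrm{Chi}(v)}f(u)$, an empty sum being $0$. A bounded operator $T$ on $X$ is hypercyclic (resp. weakly hypercyclic) if there is $x\in X$ such that $\{T^nx:n\in\mathbb{N}_0\}$ is norm dense (resp. dense for the weak topology) in $X$. $\mathrm{Orb}(C,B)=\bigcup_{n\in\mathbb{N}_0}B^n(C)$. *)

(* Defs.v *)
From HB Require Import structures.
From mathcomp Require Import all_boot all_order all_algebra finmap.
From mathcomp Require Import all_classical all_reals all_analysis.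
From mathcomp Require Import complex.
From mathcomp Require summability.

Set Implicit Arguments.
Unset Strict Implicit.
Unset Printing Implicit Defensive.

Import Order.TTheory GRing.Theory Num.Theory.
Import numFieldNormedType.Exports.

Local Open Scope classical_set_scope.
Local Open Scope ring_scope.

Section DirectedTree.
Variables (V : countType) (E : rel V).

Record directed_tree : Prop := DirectedTree {
  tree_nonempty : inhabited V;
  tree_irreflexive : irreflexive E;
  tree_connected : forall u v : V, u != v ->
    exists2 s : seq V, path (fun x y => E x y || E y x) u s & last u s = v;
  tree_no_circuit : forall c : seq V,
    (2 <= size c)%N -> uniq c -> ~~ cycle E c;
  tree_parent_unique : forall u u' v : V, E u v -> E u' v -> u = u'
}.

Definition is_root (r : V) : Prop := forall u : V, ~~ E u r.

Definition rooted_directed_tree : Prop :=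
  directed_tree /\ exists r : V, is_root r.

(* As edges point from parents to children and parents are unique,
   par(u) = v means that (v, u) is an edge. *)
Definition Chi (v : V) : {pred V} := [pred u | E v u].

End DirectedTree.

Variant scalar_kind := RealScalars | ComplexScalars.

Definition scalars (R : realType) (k : scalar_kind) : numFieldType :=
  match k with
  | RealScalars => R
  | ComplexScalars => R[i]
  end.

(* The norm of a normedModType over K takes its values in K, whereas real
   powers, suprema and sums of non-negative terms live in R. *)
Definition of_real (R : realType) (k : scalar_kind) : R -> scalars R k :=
  match k with
  | RealScalars => fun x => x
  | ComplexScalars => fun x => (x%:C)%C
  end.

Definition modulus (R : realType) (k : scalar_kind) : scalars R k -> R :=
  match k with
  | RealScalars => fun x => `|x|
  | ComplexScalars => fun z => complex.Re `|z|
  end.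

Arguments of_real {R k} x.
Arguments modulus {R k} z.

Section Scalars.
Context {R : realType} {k : scalar_kind}.
Local Notation K := (scalars R k).

Lemma normE (z : K) : `|z| = of_real (modulus z).
Proof. by case: k z => //= -[a b]. Qed.

Lemma of_realD : {morph @of_real R k : x y / x + y}.
Proof. by case: k => //= x y; rewrite rmorphD. Qed.

Lemma of_realM : {morph @of_real R k : x y / x * y}.
Proof. by case: k => //= x y; rewrite rmorphM. Qed.

Lemma of_real_inj : injective (@of_real R k).
Proof. by case: k => //= x y []. Qed.

Lemma of_real0 : of_real 0 = 0 :> K.
Proof. by case: k. Qed.

Lemma ler_of_real : {mono @of_real R k : x y / x <= y}.
Proof. by case: k => //= x y; rewrite lecR. Qed.

Lemma modulus_ge0 (z : K) : 0 <= modulus z.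
Proof. by rewrite -ler_of_real -normE of_real0. Qed.

Lemma modulus0 : modulus (0 : K) = 0.
Proof. by apply: of_real_inj; rewrite -normE of_real0 normr0. Qed.

Lemma modulus_eq0 (z : K) : modulus z = 0 -> z = 0.
Proof. by move=> z0; apply/eqP; rewrite -normr_eq0 normE z0 of_real0. Qed.

Lemma modulusM (y z : K) : modulus (y * z) = modulus y * modulus z.
Proof. by apply: of_real_inj; rewrite of_realM -!normE normrM. Qed.

Lemma ler_modulusD (y z : K) : modulus (y + z) <= modulus y + modulus z.
Proof. by rewrite -ler_of_real of_realD -!normE ler_normD. Qed.

End Scalars.

Record weight (R : realType) (k : scalar_kind) (V : Type) := Weight {
  weight_fun :> V -> scalars R k;
  weight_neq0 : forall v, weight_fun v != 0
}.

Variant space_kind (R : realType) :=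
  | EllP (p : R) of 1 <= p
  | CZero.

Arguments CZero {R}.

Section WeightedSpace.
Context {R : realType} {k : scalar_kind} {V : countType}.
Variables (mu : weight R k V) (s : space_kind R).
Local Notation K := (scalars R k).

Definition in_space (f : V -> K) : Prop :=
  match s with
  | EllP p _ => (\esum_(v in [set: V]) (modulus (f v * mu v) `^ p)%:E < +oo)%E
  | CZero => forall e : R, 0 < e ->
      exists2 F : set V, finite_set F &
        forall v, ~ F v -> modulus (f v * mu v) < e
  end.

Definition space_norm (f : V -> K) : R :=
  match s with
  | EllP p _ =>
      fine (\esum_(v in [set: V]) (modulus (f v * mu v) `^ p)%:E)%E `^ p^-1
  | CZero => sup [set modulus (f v * mu v) | v in [set: V]]
  end.

End WeightedSpace.

Section LpBounds.
Context {R : realType} {V : countType}.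
Implicit Types (a b : V -> R) (p M : R).

Lemma esum_leP a M : (\esum_(v in [set: V]) (a v)%:E <= M%:E)%E <->
  forall F : {fset V}, \sum_(v <- F) a v <= M.
Proof.
split=> [le_aM F|le_aM].
  rewrite -lee_fin; apply: le_trans le_aM.
  apply: ereal_sup_ubound; exists [set` F] => //.
  by rewrite fsbig_finite// set_fsetK sumEFin.
apply: ge_ereal_sup => _ [F [finF _] <-].
by rewrite fsbig_finite// sumEFin lee_fin.
Qed.

Lemma powR_mean p (x y c d : R) : 1 <= p -> 0 <= x -> 0 <= y -> 0 < c -> 0 < d ->
  (x + y) `^ p <= (c + d) `^ p *
    (c / (c + d) * (x `^ p / c `^ p) + d / (c + d) * (y `^ p / d `^ p)).
Proof.
move=> p1 x0 y0 c0 d0; have cd0 : 0 < c + d by rewrite addr_gt0.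
have p0 : 0 <= p by rewrite (le_trans _ p1).
have c1 : 0 <= c / (c + d) by rewrite divr_ge0// ltW.
have c2 : c / (c + d) <= 1 by rewrite ler_pdivrMr// mul1r lerDl ltW.
have := @convex_powR R p p1 (Itv01 c1 c2) (x / c) (y / d).
rewrite !inE/= !in_itv/= !andbT !divr_ge0 ?(ltW c0) ?(ltW d0)// => /(_ isT isT) H0.
rewrite convRE [X in X `^ _ <= _]convRE/= /unstable.onem in H0.
move: H0.
have -> : 1 - c / (c + d) = d / (c + d).
  by rewrite -[1](@divff _ (c + d)) ?gt_eqF// -mulrBl addrAC subrr add0r.
have -> : c / (c + d) * (x / c) + d / (c + d) * (y / d) = (x + y) / (c + d).
  rewrite mulrDl; congr (_ + _); rewrite mulrC mulrA.
    by rewrite mulfVK ?gt_eqF.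
  by rewrite mulfVK ?gt_eqF.
move=> H.
have powRV z : 0 < z -> (z^-1) `^ p = (z `^ p)^-1.
  by move=> z0; rewrite -powRN -[in LHS](powR_inv1 (ltW z0)) -powRrM mulN1r.
have -> : (x + y) `^ p = (c + d) `^ p * ((x + y) / (c + d)) `^ p.
  rewrite -powRM ?(ltW cd0) ?divr_ge0 ?addr_ge0 ?(ltW c0) ?(ltW d0)//.
  by rewrite mulrC mulfVK ?gt_eqF.
rewrite ler_wpM2l ?powR_ge0//; apply: le_trans H _.
by rewrite !powRM ?invr_ge0 ?(ltW c0) ?(ltW d0)// !powRV.
Qed.

Lemma lp_addE p a b c d : 1 <= p -> (forall v, 0 <= a v) -> (forall v, 0 <= b v) ->
  0 < c -> 0 < d ->
  (\esum_(v in [set: V]) (a v `^ p)%:E <= (c `^ p)%:E)%E ->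
  (\esum_(v in [set: V]) (b v `^ p)%:E <= (d `^ p)%:E)%E ->
  (\esum_(v in [set: V]) ((a v + b v) `^ p)%:E <= ((c + d) `^ p)%:E)%E.
Proof.
move=> p1 a0 b0 c0 d0 /esum_leP ac /esum_leP bd; apply/esum_leP => F.
apply: le_trans (ler_sum _ (fun v _ => powR_mean p1 (a0 v) (b0 v) c0 d0)) _.
rewrite -mulr_sumr big_split/= -!mulr_sumr -!mulr_suml.
rewrite -[leRHS]mulr1 ler_wpM2l ?powR_ge0//.
have cd0 : 0 < c + d by rewrite addr_gt0.
have -> : 1 = c / (c + d) + d / (c + d) by rewrite -mulrDl divff ?gt_eqF.
apply: lerD; rewrite -[leRHS]mulr1 ler_wpM2l ?divr_ge0 ?(ltW c0) ?(ltW d0) ?(ltW cd0)//.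
  by rewrite ler_pdivrMr ?powR_gt0// mul1r.
by rewrite ler_pdivrMr ?powR_gt0// mul1r.
Qed.

Lemma lp_scale p a l M : 1 <= p -> (forall v, 0 <= a v) -> 0 <= l ->
  (\esum_(v in [set: V]) (a v `^ p)%:E <= M%:E)%E ->
  (\esum_(v in [set: V]) ((l * a v) `^ p)%:E <= (l `^ p * M)%:E)%E.
Proof.
move=> p1 a0 l0 /esum_leP aM; apply/esum_leP => F.
under eq_bigr do rewrite powRM//.
by rewrite -mulr_sumr ler_wpM2l ?powR_ge0.
Qed.

Lemma le_lp p a b : 1 <= p -> (forall v, 0 <= a v <= b v) ->
  (\esum_(v in [set: V]) (a v `^ p)%:E <= \esum_(v in [set: V]) (b v `^ p)%:E)%E.
Proof.
move=> p1 ab; apply: le_esum => v _; have /andP[av abv] := ab v.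
rewrite lee_fin ge0_ler_powR ?nnegrE ?(le_trans _ p1)//.
exact: le_trans abv.
Qed.

End LpBounds.

Section Seminorm.
Context {R : realType} {k : scalar_kind} {V : countType}.
Variables (mu : weight R k V) (s : space_kind R).
Local Notation K := (scalars R k).
Implicit Types f g : V -> K.

Let md f v := modulus (f v * mu v).

Let md_ge0 f v : 0 <= md f v. Proof. exact: modulus_ge0. Qed.

Let mdD f g v : md (f + g) v <= md f v + md g v.
Proof. by rewrite /md fctE mulrDl ler_modulusD. Qed.

Let mdZ (l : K) f v : md (l *: f) v = modulus l * md f v.
Proof. by rewrite /md fctE -mulrA modulusM. Qed.

Let S p f := (\esum_(v in [set: V]) (md f v `^ p)%:E)%E.

Let S_ge0 p f : (0 <= S p f)%E.
Proof. by apply: esum_ge0 => v _; rewrite lee_fin powR_ge0. Qed.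

Let S_fine p f : (S p f < +oo)%E -> S p f = (fine (S p f))%:E.
Proof. by move=> fin; rewrite fineK// ge0_fin_numE. Qed.

Let powRK p (x : R) : 1 <= p -> 0 <= x -> (x `^ p^-1) `^ p = x.
Proof.
move=> p1 x0; rewrite -powRrM mulVf ?powRr1// gt_eqF//.
exact: lt_le_trans ltr01 p1.
Qed.

Let powRVK p (x : R) : 1 <= p -> 0 <= x -> (x `^ p) `^ p^-1 = x.
Proof.
move=> p1 x0; rewrite -powRrM mulfV ?powRr1// gt_eqF//.
exact: lt_le_trans ltr01 p1.
Qed.

Let S_leP p f (M : R) : 1 <= p -> 0 <= M -> (S p f < +oo)%E ->
  (S p f <= (M `^ p)%:E)%E = (fine (S p f) `^ p^-1 <= M).
Proof.
move=> p1 M0 fin; have p0 : 0 < p := lt_le_trans ltr01 p1.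
rewrite {1}S_fine// lee_fin; have S0 : 0 <= fine (S p f) by exact: fine_ge0.
apply/idP/idP => H.
  rewrite -[leRHS](powRVK p1 M0) ge0_ler_powR ?nnegrE ?powR_ge0//.
  by rewrite invr_ge0 ltW.
by rewrite -[leLHS](powRK p1 S0) ge0_ler_powR ?nnegrE ?powR_ge0// ltW.
Qed.

Let S_add (p : R) f g (c d : R) : 1 <= p -> 0 < c -> 0 < d ->
  (S p f <= (c `^ p)%:E -> S p g <= (d `^ p)%:E ->
   S p (f + g)%R <= ((c + d) `^ p)%:E)%E.
Proof.
move=> p1 c0 d0 fc gd.
apply: le_trans (lp_addE p1 (md_ge0 f) (md_ge0 g) c0 d0 fc gd).
by apply: le_lp => // v; rewrite md_ge0 mdD.
Qed.

Let S_scale p (l : K) f M : 1 <= p ->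
  (S p f <= M%:E -> S p (l *: f)%R <= (modulus l `^ p * M)%:E)%E.
Proof.
move=> p1 fM.
apply: le_trans (lp_scale p1 (md_ge0 f) (modulus_ge0 l) fM).
by apply: le_lp => // v; rewrite md_ge0 mdZ lexx.
Qed.

Let S_bound p f : 1 <= p -> (S p f < +oo)%E ->
  forall e, 0 < e -> (S p f <= ((fine (S p f) `^ p^-1 + e) `^ p)%:E)%E.
Proof.
move=> p1 fin e e0; rewrite S_leP//; first by rewrite lerDl ltW.
by rewrite addr_ge0 ?powR_ge0// ltW.
Qed.

Let c0_bounded f : in_space mu CZero f -> has_ubound [set md f v | v in [set: V]].
Proof.
move=> /(_ 1 ltr01)[F finF H].
exists (1 + \sum_(u <- fset_set F) md f u) => _ [v _ <-].
have [Fv|nFv] := pselect (F v).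
  have vF : v \in fset_set F by rewrite in_fset_set// inE.
  by rewrite (big_rem v)//= addrCA lerDl addr_ge0// sumr_ge0.
by rewrite (le_trans (ltW (H _ nFv)))// lerDl sumr_ge0.
Qed.

Lemma in_space0 : in_space mu s 0.
Proof.
have m0 v : modulus ((0 : V -> K) v * mu v) = 0 by rewrite mul0r modulus0.
case: s => [p p1|] /=; last by move=> e e0; exists set0 => // v _; rewrite m0.
rewrite esum1 ?ltry// => v _; rewrite m0 powR0// gt_eqF//.
exact: lt_le_trans ltr01 p1.
Qed.

Lemma in_spaceD f g : in_space mu s f -> in_space mu s g -> in_space mu s (f + g).
Proof.
case: s => [p p1 /= finf fing|].
  have N0 h : 0 < fine (S p h) `^ p^-1 + 1 by rewrite ltr_wpDl ?powR_ge0.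
  apply: le_lt_trans (ltry _); apply: (S_add p1 (N0 f) (N0 g)).
    exact: S_bound.
  exact: S_bound.
move=> /= Hf Hg e e0; have e20 : 0 < e / 2 by rewrite divr_gt0.
have [F finF HF] := Hf _ e20; have [G finG HG] := Hg _ e20.
exists (F `|` G); first by rewrite finite_setU.
move=> v /not_orP[nF nG]; apply: le_lt_trans (mdD f g v) _.
by rewrite [ltRHS]splitr ltrD ?HF ?HG.
Qed.

Lemma in_spaceZ (l : K) f : in_space mu s f -> in_space mu s (l *: f).
Proof.
case: s => [p p1 /= finf|].
  have H : (S p f <= (fine (S p f))%:E)%E by rewrite -S_fine.
  exact: le_lt_trans (S_scale l p1 H) (ltry _).
move=> /= Hf e e0; have l0 : 0 < modulus l + 1 by rewrite ltr_wpDl ?modulus_ge0.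
have [F finF HF] := Hf _ (divr_gt0 e0 l0); exists F => // v /HF.
rewrite -/(md f v) -/(md (l *: f) v) mdZ ltr_pdivlMr// => H.
apply: le_lt_trans H; rewrite mulrC ler_wpM2l ?md_ge0//.
by rewrite lerDl.
Qed.

Lemma space_normD f g : in_space mu s f -> in_space mu s g ->
  space_norm mu s (f + g) <= space_norm mu s f + space_norm mu s g.
Proof.
move=> sf sg; have := in_spaceD sf sg; move: sf sg.
case: s => [p p1 /= finf fing finfg|].
  rewrite -/(S p f) -/(S p g) -/(S p (f + g)).
  apply/ler_addgt0Pr => e e0; have e20 : 0 < e / 2 by rewrite divr_gt0.
  have N0 h : 0 < fine (S p h) `^ p^-1 + e / 2 by rewrite ltr_wpDl ?powR_ge0.
  have -> : fine (S p f) `^ p^-1 + fine (S p g) `^ p^-1 + e =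
      (fine (S p f) `^ p^-1 + e / 2) + (fine (S p g) `^ p^-1 + e / 2).
    by rewrite addrACA -splitr.
  rewrite -S_leP//; last by apply: addr_ge0; apply: ltW.
  by apply: S_add => //; apply: S_bound.
move=> sf sg sfg; have [v0|noV] := pselect (exists v : V, True); last first.
  rewrite /space_norm.
  have im0 h : [set modulus (h v * mu v) | v in [set: V]] = set0.
    by apply/seteqP; split=> // x [v _ _]; case: noV; exists v.
  by rewrite !im0 sup0 addr0.
have [v _] := v0; apply: ge_sup; first by exists (md (f + g) v); exists v.
move=> _ [u _ <-]; apply: le_trans (mdD f g u) _.
by apply: lerD; apply: ub_le_sup; [exact: c0_bounded|exists u|
  exact: c0_bounded|exists u].
Qed.

Lemma space_norm_ge0 f : 0 <= space_norm mu s f.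
Proof.
case: s => [p p1|] /=; first exact: powR_ge0.
set A := [set _ | _ in _].
have [[[x Ax] ubA]|/sup_out -> //] := pselect (has_sup A).
apply: le_trans (ub_le_sup ubA Ax); case: Ax => v _ <-; exact: modulus_ge0.
Qed.

Let space_normZ_le (l : K) f : in_space mu s f ->
  space_norm mu s (l *: f) <= modulus l * space_norm mu s f.
Proof.
move=> sf; have := in_spaceZ l sf; move: sf.
case: s => [p p1 /= finf finlf|].
  rewrite -/(S p f) -/(S p (l *: f)).
  have lN : 0 <= modulus l * fine (S p f) `^ p^-1.
    by rewrite mulr_ge0 ?modulus_ge0 ?powR_ge0.
  rewrite -S_leP// powRM ?modulus_ge0 ?powR_ge0// powRK ?fine_ge0//.
  by apply: S_scale => //; rewrite -S_fine.
move=> sf slf; have [v0|noV] := pselect (exists v : V, True); last first.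
  rewrite /space_norm.
  have im0 h : [set modulus (h v * mu v) | v in [set: V]] = set0.
    by apply/seteqP; split=> // x [v _ _]; case: noV; exists v.
  by rewrite !im0 sup0 mulr0.
have [v _] := v0; apply: ge_sup; first by exists (md (l *: f) v); exists v.
move=> _ [u _ <-]; rewrite -/(md _ u) mdZ ler_wpM2l ?modulus_ge0//.
by apply: ub_le_sup; [exact: c0_bounded|exists u].
Qed.

Lemma space_normZ (l : K) f : in_space mu s f ->
  space_norm mu s (l *: f) = modulus l * space_norm mu s f.
Proof.
move=> sf; apply/eqP; rewrite eq_le space_normZ_le//=.
have [->|l0] := eqVneq l 0; first by rewrite modulus0 mul0r space_norm_ge0.
have ml0 : 0 < modulus l.
  rewrite lt_neqAle modulus_ge0 andbT; apply/eqP => /esym/modulus_eq0/eqP.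
  exact/negP.
have := space_normZ_le l^-1 (in_spaceZ l sf).
rewrite scalerA mulVf// scale1r => /(ler_wpM2l (ltW ml0))/le_trans; apply.
rewrite mulrA -modulusM mulfV//.
suff -> : modulus (1 : K) = 1 by rewrite mul1r.
by apply: (@of_real_inj R k); rewrite -normE normr1; case: (k).
Qed.

Lemma space_norm_eq0 f : in_space mu s f -> space_norm mu s f = 0 -> f = 0.
Proof.
move=> sf N0; suff md0 v : md f v = 0.
  apply/funext => v; have /modulus_eq0/eqP := md0 v.
  by rewrite mulf_eq0 (negbTE (weight_neq0 mu v)) orbF => /eqP.
apply/eqP; rewrite eq_le md_ge0 andbT; move: sf N0.
case: s => [p p1 /= finf|/= sf <-]; last first.
  by apply: ub_le_sup; [exact: c0_bounded|exists v].
rewrite -/(S p f) => N0.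
have : (S p f <= (0 `^ p)%:E)%E by rewrite S_leP// N0.
move=> /esum_leP/(_ [fset v]%fset); rewrite big_seq_fset1.
rewrite powR0 ?gt_eqF ?(lt_le_trans ltr01 p1)// => H.
have : md f v `^ p = 0 by apply/eqP; rewrite eq_le H powR_ge0.
by move=> /powR_eq0_eq0 ->.
Qed.

End Seminorm.

Section SpaceType.
Context {R : realType} {k : scalar_kind} {V : countType}.
Variables (mu : weight R k V) (s : space_kind R).
Local Notation K := (scalars R k).

Definition space_pred : {pred V -> K} := [pred f | `[< in_space mu s f >]].

Record wspace := WSpace {
  wspace_fun :> V -> K;
  wspace_funP : wspace_fun \in space_pred
}.

HB.instance Definition _ := [isSub for wspace_fun].
HB.instance Definition _ := [Choice of wspace by <:].

Lemma space_pred_submod : submod_closed space_pred.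
Proof.
split=> [|l f g /asboolP sf /asboolP sg]; apply/asboolP.
  exact: in_space0.
by apply: in_spaceD => //; exact: in_spaceZ.
Qed.

HB.instance Definition _ :=
  GRing.isSubmodClosed.Build K (V -> K) space_pred space_pred_submod.
HB.instance Definition _ := [SubChoice_isSubLmodule of wspace by <:].

Let in_spaceP (f : wspace) : in_space mu s f.
Proof. by have /asboolP := wspace_funP f. Qed.

Let norm (f : wspace) : K := of_real (space_norm mu s f).

Let norm_le_add (f g : wspace) : norm (f + g) <= norm f + norm g.
Proof. by rewrite /norm -of_realD ler_of_real; exact: space_normD. Qed.

Let norm_scale (l : K) (f : wspace) : norm (l *: f) = `|l| * norm f.
Proof. by rewrite /norm normE -of_realM space_normZ. Qed.

Let norm_eq0 (f : wspace) : norm f = 0 -> f = 0.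
Proof.
move=> f0; apply: val_inj; apply: (space_norm_eq0 (in_spaceP f)).
by apply: (@of_real_inj R k); rewrite -/(norm f) f0 of_real0.
Qed.

HB.instance Definition _ :=
  Lmodule_isNormed.Build K wspace norm_le_add norm_scale norm_eq0.

Lemma space_normE (f : wspace) : `|f| = of_real (space_norm mu s f).
Proof. by []. Qed.

End SpaceType.

(* Chi v may be infinite: the sum over Chi v is then unconditional, i.e. a
   limit along the directed set of the finite subsets of Chi v. *)
Definition is_backward_shift (R : realType) (k : scalar_kind) (V : countType)
    (E : rel V) (mu : weight R k V) (s : space_kind R)
    (B : wspace mu s -> wspace mu s) : Prop :=
  forall (f : wspace mu s) (v : V),
    summability.partial_sum (fun u : {u : V | u \in Chi E v} => f (val u))
      @ summability.totally --> B f v.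

Section Operators.
Context {K : numFieldType} {X : normedModType K}.

(* X with its weak topology: the coarsest one for which all the continuous
   linear functionals are continuous. *)
Definition weak : topologicalType :=
  sup_topology (fun phi : {phi : {linear X -> K^o} | continuous phi} =>
    Topological.class (initial_topology (sval phi : X -> K^o))).

Definition weakly_dense (A : set X) : Prop := dense (A : set weak).

Definition weakly_open_nbhs (x : X) (W : set X) : Prop :=
  open_nbhs (x : weak) (W : set weak).

Variable T : X -> X.

Definition bounded_operator : Prop :=
  exists M : K, forall x : X, `|T x| <= M * `|x|.

Definition hypercyclic : Prop :=
  exists x : X, dense [set iter n T x | n in [set: nat]].

Definition weakly_hypercyclic : Prop :=
  exists x : X, weakly_dense [set iter n T x | n in [set: nat]].

Definition Orb (C : set X) : set X := \bigcup_(n in [set: nat]) (iter n T @` C).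

End Operators.

Arguments weak {K} X.

(* Main.v *)
From HB Require Import structures.
Require Import Defs.
From mathcomp Require Import all_boot all_order all_algebra finmap.
From mathcomp Require Import all_classical all_reals all_analysis.
From mathcomp Require Import complex.
From mathcomp Require summability.
From mathcomp Require Import lra.

(** Everything reduces to the following property, called [shrinking]: for every
    finite set F of vertices and every e > 0 there are n and phi with
    ||phi|| <= e and |(B^n phi)(v)| >= 1 for all v in F.

    If C is bounded and Orb(C, B) is weakly dense, some B^n f with f in C takes
    values as large as we please on F; rescaling f gives phi.  Assuming (4),
    apply it to g = sum over v in F of b^(-depth v) e_v with b large: every
    weight exceeds twice the sum of the weights of the proper descendants in F,
    so that B^n (f - g) stays away from 0 on F while ||f - g|| is tiny.

    Conversely, truncating phi to the n-th generation of descendants of v and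
    normalising it gives a small finitely supported h with B^n h = e_v, and n is
    forced to be large because |(B^n phi)(root)| <= c ||B||^n ||phi||.  As the
    tree is rooted, finitely supported functions are killed by the powers of B.
    Assertion (4) follows by adding such preimages to an approximation of g, and
    a hypercyclic vector is the sum of a rapidly decreasing series of preimages
    of a dense sequence.  The depths of these preimages increase, so the partial
    sums are eventually constant at each vertex. *)

Set Implicit Arguments.
Unset Strict Implicit.
Unset Printing Implicit Defensive.

Import Order.TTheory GRing.Theory Num.Theory.
Import numFieldNormedType.Exports.

Local Open Scope classical_set_scope.
Local Open Scope ring_scope.

(** * Comparison of the weak and the norm topology *)

Section WeakTopology.
Context {K : numFieldType} {X : normedModType K}.

(** The functionals generating the weak topology are norm continuous, so the preimages that generate
    its neighbourhoods are norm neighbourhoods already. *)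
Lemma weak_le_norm (x : X) : nbhs x --> (x : weak X).
Proof.
apply/cvg_sup => -[phi cphi] A /=.
rewrite (@nbhsE (initial_topology (phi : X -> K^o))) => -[_ [[C oC <-] Cx] CA].
apply: (filterS CA); apply: (cphi x C); exact: open_nbhs_nbhs.
Qed.

Lemma weakly_open_open (W : set X) : open (W : set (weak X)) -> open W.
Proof.
rewrite !openE => oW x Wx; apply: weak_le_norm; exact: oW.
Qed.

Lemma open_weak_preimage (phi : {linear X -> K^o}) (C : set K^o) :
  continuous phi -> open C -> open (phi @^-1` C : set (weak X)).
Proof.
move=> cphi oC; rewrite openE => x Cx.
(* Convergence in a supremum of topologies is convergence in each of them; it is used here for the
   single functional [phi]. *)
have : nbhs (x : weak X) --> (x : weak X) by exact: cvg_id.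
move=> /cvg_sup/(_ (exist _ phi cphi)) /=; apply.
apply: (@open_nbhs_nbhs (initial_topology (phi : X -> K^o))).
by split=> //; exists C.
Qed.

Lemma open_weak_bigI (I : eqType) (s : seq I) (phi : I -> {linear X -> K^o})
    (C : I -> set K^o) :
  (forall i, continuous (phi i)) -> (forall i, open (C i)) ->
  open ([set x | forall i, i \in s -> C i (phi i x)] : set (weak X)).
Proof.
move=> cphi oC; elim: s => [|i s IHs].
  by rewrite (_ : [set _ | _] = setT); [exact: openT|apply/seteqP; split].
rewrite (_ : [set _ | _] =
  (phi i @^-1` C i) `&` [set x | forall j, j \in s -> C j (phi j x)]).
  exact: openI (open_weak_preimage (cphi i) (oC i)) IHs.
apply/seteqP; split=> x /= => [H|[Ci H] j /[!inE] /predU1P[->//|]]; last exact: H.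
by split=> [|j js]; apply: H; rewrite inE ?eqxx// js orbT.
Qed.

End WeakTopology.

(** * Balls, domination and truncation in the weighted spaces *)

Section SpaceFacts.
Context {R : realType} {k : scalar_kind} {V : countType}.
Variables (mu : weight R k V) (s : space_kind R).
Local Notation K := (scalars R k).
Local Notation N := (space_norm mu s).
Implicit Types (f g : V -> K) (M e : R).

(* For f in the space this says that the norm is at most M, for the l^p norms as
   for the sup norm. *)
Definition in_ball f M : Prop :=
  match s with
  | EllP p _ => forall F : {fset V},
      \sum_(v <- F) modulus (f v * mu v) `^ p <= M `^ p
  | CZero => forall v, modulus (f v * mu v) <= M
  end.

Lemma powR_invK (p x : R) : 1 <= p -> 0 <= x -> (x `^ p^-1) `^ p = x.
Proof.
move=> p1 x0; rewrite -powRrM mulVf ?powRr1// gt_eqF//.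
exact: lt_le_trans ltr01 p1.
Qed.

Lemma powR_Kinv (p x : R) : 1 <= p -> 0 <= x -> (x `^ p) `^ p^-1 = x.
Proof.
move=> p1 x0; rewrite -powRrM mulfV ?powRr1// gt_eqF//.
exact: lt_le_trans ltr01 p1.
Qed.

Lemma ler_powR_inv (p x y : R) : 1 <= p -> 0 <= x -> 0 <= y ->
  (x `^ p^-1 <= y) = (x <= y `^ p).
Proof.
move=> p1 x0 y0; have p0 : 0 < p := lt_le_trans ltr01 p1.
apply/idP/idP => H.
  by rewrite -[leLHS](powR_invK p1 x0) ge0_ler_powR ?nnegrE ?powR_ge0// ltW.
rewrite -[leRHS](powR_Kinv p1 y0) ge0_ler_powR ?nnegrE ?powR_ge0//.
by rewrite invr_ge0 ltW.
Qed.

Lemma c0_bounded f : in_space mu CZero f ->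
  has_ubound [set modulus (f v * mu v) | v in [set: V]].
Proof.
move=> /(_ 1 ltr01)[F finF H].
exists (1 + \sum_(u <- fset_set F) modulus (f u * mu u)) => _ [v _ <-].
have sum_ge0 : 0 <= \sum_(u <- fset_set F) modulus (f u * mu u).
  by apply: sumr_ge0 => u _; exact: modulus_ge0.
have [Fv|nFv] := pselect (F v); last by rewrite (le_trans (ltW (H _ nFv)))// lerDl.
have vF : v \in fset_set F by rewrite in_fset_set// inE.
rewrite (big_rem v)//= addrCA lerDl addr_ge0// sumr_ge0// => u _.
exact: modulus_ge0.
Qed.

Lemma space_norm_leP f M : in_space mu s f -> 0 <= M ->
  N f <= M <-> in_ball f M.
Proof.
rewrite /in_ball; case: s => [p p1|] /= sf M0; last first.
  split=> [fM v|fM].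
    by apply: le_trans fM; apply: ub_le_sup; [exact: c0_bounded|exists v].
  (* [ge_sup] concerns non-empty sets; for empty [V] the supremum is 0 by convention. *)
  have [[v _]|noV] := pselect (exists v : V, True); last first.
    rewrite (_ : [set _ | _ in _] = set0) ?sup0//.
    by apply/seteqP; split=> // x [v _ _]; case: noV; exists v.
  by apply: ge_sup; [exists (modulus (f v * mu v)), v|move=> _ [u _ <-]].
rewrite -esum_leP ler_powR_inv ?fine_ge0 ?esum_ge0//; last first.
  by move=> v _; rewrite lee_fin powR_ge0.
rewrite -lee_fin fineK// ge0_fin_numE// esum_ge0// => v _.
by rewrite lee_fin powR_ge0.
Qed.

Lemma in_ball_norm f : in_space mu s f -> in_ball f (N f).
Proof. by move=> sf; apply/space_norm_leP => //; exact: space_norm_ge0. Qed.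

Lemma in_ball_le f g M : (forall v, modulus (g v) <= modulus (f v)) ->
  in_ball f M -> in_ball g M.
Proof.
move=> gf; have gfm v : modulus (g v * mu v) <= modulus (f v * mu v).
  by rewrite !modulusM ler_wpM2r// modulus_ge0.
rewrite /in_ball; case: s => [p p1 fM F|fM v]; last exact: le_trans (fM v).
apply: le_trans (fM F); apply: ler_sum => v _.
by rewrite ge0_ler_powR ?nnegrE ?modulus_ge0// (le_trans _ p1).
Qed.

Lemma in_space_le f g : (forall v, modulus (g v) <= modulus (f v)) ->
  in_space mu s f -> in_space mu s g.
Proof.
move=> gf; have gfm v : modulus (g v * mu v) <= modulus (f v * mu v).
  by rewrite !modulusM ler_wpM2r// modulus_ge0.
case: s => [p p1|] /= sf; last first.
  move=> e /sf[F finF H]; exists F => // v Fv; exact: le_lt_trans (H v Fv).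
apply: le_lt_trans sf; apply: le_esum => v _.
by rewrite lee_fin ge0_ler_powR ?nnegrE ?modulus_ge0// (le_trans _ p1).
Qed.

Lemma space_norm_le f g : (forall v, modulus (g v) <= modulus (f v)) ->
  in_space mu s f -> N g <= N f.
Proof.
move=> gf sf; apply/space_norm_leP; first exact: in_space_le sf.
  exact: space_norm_ge0.
exact: in_ball_le (in_ball_norm sf).
Qed.

Lemma coordinate_le_norm f v : in_space mu s f ->
  modulus (f v) * modulus (mu v) <= N f.
Proof.
move=> /in_ball_norm; rewrite -modulusM /in_ball.
have := space_norm_ge0 mu s f.
case: s => [p p1|] /= N0; last by apply.
move=> /(_ [fset v]%fset); rewrite big_seq_fset1 -(ler_powR_inv p1) ?powR_ge0//.
by rewrite powR_Kinv// modulus_ge0.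
Qed.

Lemma in_space_indic u : in_space mu s (fun v => (v == u)%:R).
Proof.
case: s => [p p1|] /=; last first.
  move=> e e0; exists [set u] => // v /= /eqP/negbTE ->.
  by rewrite mul0r modulus0.
apply: le_lt_trans (ltry (modulus (mu u) `^ p)); apply/esum_leP => F.
rewrite (eq_bigr (fun v => if v == u then modulus (mu u) `^ p else 0)).
  rewrite -big_mkcond/= big_const_seq iter_addr_0.
  have : (count (eq_op^~ u) F <= 1)%N by rewrite (count_uniq_mem u (fset_uniq F)) leq_b1.
  by case: count => [|[|]]//; rewrite ?mulr0n ?powR_ge0.
move=> v _; case: eqP => [->|_]; first by rewrite mul1r.
by rewrite mul0r modulus0 powR0// gt_eqF// (lt_le_trans _ p1).
Qed.

(** For [EllP], choose [F] whose partial sum is within [e ^ p] of the total: every finite sum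
    outside [F] is then below [e ^ p]. For [CZero] this is vanishing at infinity. *)
Lemma space_norm_tail f e : in_space mu s f -> 0 < e ->
  exists F : {fset V}, N (fun v => if v \in F then 0 else f v) <= e.
Proof.
move=> sf e0.
have sg (F : {fset V}) : in_space mu s (fun v => if v \in F then 0 else f v).
  apply: in_space_le sf => v; case: ifP => // _.
  by rewrite modulus0 modulus_ge0.
suff [F HF] : exists F : {fset V}, in_ball (fun v => if v \in F then 0 else f v) e.
  by exists F; apply/space_norm_leP => //; exact: ltW.
move: sf {sg}; rewrite /in_ball; case: s => [p p1|] /= sf; last first.
  have [F finF H] := sf e e0; exists (fset_set F) => v.
  case: ifPn => [_|]; first by rewrite mul0r modulus0 ltW.
  by rewrite in_fset_set// notin_setE => /H/ltW.
pose a v := modulus (f v * mu v) `^ p.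
have a0 v : 0 <= a v by exact: powR_ge0.
have fin : \esum_(v in [set: V]) (a v)%:E \is a fin_num.
  by rewrite ge0_fin_numE// esum_ge0// => v _; rewrite lee_fin.
have [F HF] : exists F : {fset V},
    fine (\esum_(v in [set: V]) (a v)%:E) < \sum_(v <- F) a v + e `^ p.
  apply: contrapT => /forallNP H.
  (* If no [F] worked, the total would be at most itself minus [e ^ p]. *)
  have : (\esum_(v in [set: V]) (a v)%:E <=
    (fine (\esum_(v in [set: V]) (a v)%:E) - e `^ p)%:E)%E.
    apply/esum_leP => F; move: (H F) => /negP; rewrite -leNgt.
    by rewrite lerBrDr.
  by rewrite -[leLHS]fineK// lee_fin lerDl oppr_ge0 leNgt powR_gt0.
exists F => G.
have H0 : \sum_(v <- G) modulus ((if v \in F then 0 else f v) * mu v) `^ p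
   = \sum_(v <- (G `\` F)%fset) a v.
  rewrite [LHS](bigID (mem F))/= [X in X + _]big1 ?add0r; last first.
    move=> v vF; rewrite vF mul0r modulus0 powR0// gt_eqF//.
    exact: lt_le_trans p1.
  rewrite (eq_bigr a) => [|v /negbTE vF]; last by rewrite /a vF.
  rewrite -big_filter; apply: perm_big; apply: uniq_perm => [||v].
  - exact: filter_uniq (fset_uniq G).
  - exact: fset_uniq.
  - by rewrite mem_filter in_fsetD.
(* Adding the sum over [F] turns the left side into the sum over the union of [F] and [G], which the
   total bounds. *)
rewrite H0 -(lerD2l (\sum_(v <- F) a v)).
apply: le_trans (ltW HF); rewrite -big_cat/=.
rewrite -lee_fin fineK//.
have /esum_leP/(_ (F `|` G)%fset) : (\esum_(v in [set: V]) (a v)%:E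
  <= (fine (\esum_(v in [set: V]) (a v)%:E))%:E)%E by rewrite fineK.
rewrite -lee_fin fineK//; apply: le_trans.
rewrite lee_fin le_eqVlt; apply/orP; left; apply/eqP; apply: perm_big.
apply: uniq_perm; rewrite ?fset_uniq//.
  rewrite cat_uniq !fset_uniq/= andbT; apply/hasPn => v.
  by rewrite in_fsetD => /andP[].
by move=> v; rewrite mem_cat in_fsetD in_fsetU; case: (v \in F).
Qed.

End SpaceFacts.

(** * Vectors of the space, coordinate functionals and finitely supported vectors *)

Section Vectors.
Context {R : realType} {k : scalar_kind} {V : countType}.
Variables (mu : weight R k V) (s : space_kind R).
Local Notation K := (scalars R k).
Local Notation X := (wspace mu s).
Local Notation N := (space_norm mu s).
Implicit Types (f g x y : X) (e : R) (u v : V).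

Lemma modulusN (z : K) : modulus (- z) = modulus z.
Proof. by apply: (@of_real_inj R k); rewrite -!normE normrN. Qed.

Lemma modulus1 : modulus (1 : K) = 1.
Proof. by apply: (@of_real_inj R k); rewrite -normE normr1; case: (k). Qed.

Lemma modulus_gt0 (z : K) : z != 0 -> 0 < modulus z.
Proof.
move=> z0; rewrite lt_neqAle modulus_ge0 andbT; apply/eqP => /esym/modulus_eq0.
exact/eqP.
Qed.

Lemma modulusV (z : K) : modulus z^-1 = (modulus z)^-1.
Proof.
have [->|z0] := eqVneq z 0; first by rewrite invr0 modulus0 invr0.
apply: (mulfI (lt0r_neq0 (modulus_gt0 z0))).
by rewrite -modulusM !mulfV ?modulus1// lt0r_neq0// modulus_gt0.
Qed.

Lemma modulus_of_real (a : R) : modulus (of_real a : K) = `|a|.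
Proof.
apply: (@of_real_inj R k); rewrite -normE; case: k => //=.
by rewrite normc_def/= expr0n addr0 sqrtr_sqr.
Qed.

Lemma ler_modulusB (y z : K) : modulus y - modulus z <= modulus (y - z).
Proof. by rewrite lerBlDr -{1}(subrK z y) ler_modulusD. Qed.

Lemma modulus_sum (I : Type) (r : seq I) (P : pred I) (F : I -> K) :
  modulus (\sum_(i <- r | P i) F i) <= \sum_(i <- r | P i) modulus (F i).
Proof.
elim/big_ind2: _ => [|a b c d ab cd|//]; first by rewrite modulus0.
by apply: le_trans (ler_modulusD _ _) _; exact: lerD.
Qed.

Lemma of_real_gt0 e : 0 < e -> 0 < of_real e :> K.
Proof.
move=> e0; rewrite lt_neqAle -[X in X != _](@of_real0 R k) -[X in X <= _](@of_real0 R k).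
rewrite ler_of_real ltW// andbT; apply/eqP => /of_real_inj e00.
by rewrite -e00 ltxx in e0.
Qed.

(** Over the complex numbers too, only real scalars are positive. *)
Lemma gt0_of_real (z : K) : 0 < z -> z = of_real (modulus z).
Proof. by move=> z0; rewrite -normE gtr0_norm. Qed.

Lemma ltr_of_real : {mono @of_real R k : a b / a < b}.
Proof.
by move=> a b; rewrite !lt_neqAle ler_of_real (inj_eq (@of_real_inj R k)).
Qed.

Lemma in_spaceP f : in_space mu s f.
Proof. by have /asboolP := wspace_funP f. Qed.

Lemma wspaceE (g : V -> K) : in_space mu s g -> exists f, f =1 g.
Proof. by move=> /asboolP sg; exists (WSpace sg). Qed.

Lemma wspaceP f g : f =1 g -> f = g.
Proof. by move=> fg; apply: val_inj; apply/funext. Qed.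

Lemma wspaceD f g v : (f + g) v = f v + g v. Proof. by []. Qed.
Lemma wspaceB f g v : (f - g) v = f v - g v. Proof. by []. Qed.
Lemma wspaceZ (a : K) f v : (a *: f) v = a * f v. Proof. by []. Qed.
Lemma wspace0 v : (0 : X) v = 0. Proof. by []. Qed.

Lemma wspace_sum (I : Type) (r : seq I) (P : pred I) (F : I -> X) v :
  (\sum_(i <- r | P i) F i) v = \sum_(i <- r | P i) F i v.
Proof. by elim/big_rec2: _ => // i a b _ <-. Qed.

Lemma wnormD f g : N (f + g) <= N f + N g.
Proof. exact: space_normD (in_spaceP f) (in_spaceP g). Qed.

Lemma wnormZ (a : K) f : N (a *: f) = modulus a * N f.
Proof. exact: space_normZ (in_spaceP f). Qed.

Lemma wnorm0 : N (0 : X) = 0.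
Proof. by rewrite -(scale0r 0) wnormZ modulus0 mul0r. Qed.

Lemma wnormN f : N (- f) = N f.
Proof. by rewrite -scaleN1r wnormZ modulusN modulus1 mul1r. Qed.

Lemma wnormB f g : N (f - g) = N (g - f).
Proof. by rewrite -opprB wnormN. Qed.

Lemma wnorm_triangle g f h : N (f - h) <= N (f - g) + N (g - h).
Proof. by rewrite -{1}(subrK g f) -addrA wnormD. Qed.

Definition coordinate v f : K^o := f v.

Lemma coordinate_is_linear v : linear (coordinate v).
Proof. by []. Qed.

HB.instance Definition _ (v : V) :=
  GRing.isLinear.Build K X K^o *:%R (coordinate v) (coordinate_is_linear v).

(** As [mu v] is non-zero, [coordinate_le_norm] bounds this functional by the inverse of its
    modulus. *)
Lemma continuous_coordinate v : continuous (coordinate v).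
Proof.
apply: bounded_linear_continuous; apply/linear_boundedP.
near=> r => f; rewrite /coordinate normE space_normE.
apply: (@le_trans _ _ (of_real (modulus (mu v))^-1 * of_real (N f))).
  rewrite -of_realM ler_of_real ler_pdivlMl ?modulus_gt0 ?weight_neq0//.
  by rewrite mulrC coordinate_le_norm//; exact: in_spaceP.
apply: ler_wpM2r; first by rewrite -[leLHS](@of_real0 R k) ler_of_real space_norm_ge0.
near: r; apply: nbhs_pinfty_ge.
by apply: gtr0_real; rewrite of_real_gt0// invr_gt0 modulus_gt0 ?weight_neq0.
Unshelve. all: by end_near. Qed.

Lemma wopen_ball (O : set X) x : open O -> O x ->
  exists2 e, 0 < e & forall y, N (y - x) < e -> O y.
Proof.
move=> oO Ox; have := open_nbhs_nbhs (conj oO Ox).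
move=> /nbhs_normP[/= d d0 dO]; exists (modulus d).
  by rewrite -ltr_of_real -gt0_of_real// of_real0.
move=> y yx; apply: dO => /=; rewrite space_normE wnormB.
by rewrite (gt0_of_real d0) ltr_of_real.
Qed.

Lemma open_nbhs_wball x e : 0 < e -> open_nbhs x [set y | N (y - x) < e].
Proof.
move=> e0; rewrite (_ : [set _ | _] = ball x (of_real e)).
  by split; [exact: ball_open|apply: ballxx; exact: of_real_gt0].
rewrite -ball_normE; apply/seteqP; split=> y /=;
  by rewrite space_normE ltr_of_real wnormB.
Qed.

Definition delta u : X :=
  WSpace (asboolT (in_space_indic mu s u)).

Lemma deltaE u v : delta u v = (v == u)%:R.
Proof. by []. Qed.

(** A vertex may occur several times in the list: addition is then concatenation, and the lists with
    coefficients in a countable set can be enumerated. *)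
Definition lincomb (t : seq (V * K)) : X := \sum_(p <- t) p.2 *: delta p.1.

Lemma lincomb_fset (F : {fset V}) (f : V -> K) v :
  lincomb [seq (u, f u) | u <- F] v = if v \in F then f v else 0.
Proof.
rewrite /lincomb big_map wspace_sum.
rewrite (eq_bigr (fun u => f u * (v == u)%:R))//.
case: ifPn => [vF|vF]; last first.
  rewrite big_seq big1// => u uF; case: eqP vF => [->|_ _]; last by rewrite mulr0.
  by rewrite uF.
rewrite (big_fsetD1 v)//= eqxx mulr1 big_seq big1 ?addr0// => u.
by rewrite in_fsetD1 eq_sym => /andP[/negbTE -> _]; rewrite mulr0.
Qed.

Lemma dense_lincomb x e : 0 < e -> exists t, N (x - lincomb t) < e.
Proof.
move=> e0; have e20 : 0 < e / 2 by rewrite divr_gt0.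
have [F HF] := space_norm_tail (in_spaceP x) e20.
exists [seq (u, x u) | u <- F].
apply: (@le_lt_trans _ _ (e / 2)); last by rewrite ltr_pdivrMr// ltr_pMr// ltr1n.
apply: le_trans HF; apply: space_norm_le.
  move=> v; rewrite wspaceB lincomb_fset.
  by case: ifP => _; rewrite ?subrr ?subr0.
apply: in_space_le (in_spaceP x) => v; case: ifP => // _.
by rewrite modulus0 modulus_ge0.
Qed.

End Vectors.

(** * Ancestors and depth in a rooted tree *)

Section Tree.
Variables (V : countType) (E : rel V).

Definition parent (u : V) : option V :=
  if pselect (exists v, E v u) is left ex then Some (xchoose ex) else None.

(* Chi^n(v) is the set of the u such that [ancestor n u = Some v]. *)
Definition ancestor (n : nat) (u : V) : option V :=
  iter n (obind parent) (Some u).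

Hypothesis treeE : directed_tree E.

Lemma parentP u v : (parent u == Some v) = E v u.
Proof.
rewrite /parent; case: pselect => [ex|nex]; last first.
  by apply/esym/negP => Evu; apply: nex; exists v.
apply/eqP/idP => [[<-]|Evu]; first exact: xchooseP ex.
by congr Some; exact: tree_parent_unique treeE _ _ _ (xchooseP ex) Evu.
Qed.

Lemma iter_obind_None n : iter n (obind parent) None = None.
Proof. by elim: n => //= n ->. Qed.

Lemma ancestorD m n u v : ancestor n u = Some v ->
  ancestor (m + n) u = ancestor m v.
Proof. by rewrite /ancestor iterD => ->. Qed.

Variable r : V.
Hypothesis root_r : is_root E r.

Lemma parent_root : parent r = None.
Proof.
case Hr : (parent r) => [v|//]; move/eqP: Hr; rewrite parentP.
by rewrite (negbTE (root_r v)).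
Qed.

(** Descending from [r] is a property that passes along an edge in either direction, hence along an
    undirected path starting at [r]. *)
Lemma root_ancestor u : exists n, ancestor n u = Some r.
Proof.
have step x y : E x y || E y x ->
    (exists n, ancestor n x = Some r) -> exists n, ancestor n y = Some r.
  case/orP; rewrite -parentP => /eqP pxy [n].
    by move=> nx; exists n.+1; rewrite /ancestor iterSr /= pxy.
  (* Here [y] is the parent of [x]. For [n = 0] the vertex [x] would be the root, which has no
     parent. *)
  case: n => [|n]; last by rewrite /ancestor iterSr /= pxy; exists n.
  by move=> [xr]; move: pxy; rewrite xr parent_root.
have walk p x : (exists n, ancestor n x = Some r) ->
    path (fun x y => E x y || E y x) x p ->
    exists n, ancestor n (last x p) = Some r.
  elim: p x => //= y p IHp x hx /andP[xy yp].
  by apply: IHp yp; exact: step hx.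
have hr : exists n, ancestor n r = Some r by exists 0%N.
have [->//|ur] := eqVneq u r; have ru : r != u by rewrite eq_sym.
by have [p rp <-] := tree_connected treeE ru; exact: walk rp.
Qed.

Definition depth u : nat := projT1 (cid (root_ancestor u)).

Lemma ancestor_depth u : ancestor (depth u) u = Some r.
Proof. by rewrite /depth; case: cid. Qed.

Lemma ancestor_gt_depth n u : (depth u < n)%N -> ancestor n u = None.
Proof.
move=> un; rewrite -(subnK un) addnS -addSn.
rewrite (ancestorD _ (ancestor_depth u)) /ancestor iterSr /= parent_root.
exact: iter_obind_None.
Qed.

Lemma depth_uniq n u : ancestor n u = Some r -> depth u = n.
Proof.
move=> nu; have [un|nu'|//] := ltngtP (depth u) n.
  by rewrite ancestor_gt_depth in nu.
have := ancestor_depth u; rewrite -(subnK nu') addnS -addSn.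
by rewrite (ancestorD _ nu) /ancestor iterSr /= parent_root iter_obind_None.
Qed.

Lemma depth_ancestor n u v : ancestor n u = Some v -> depth u = (depth v + n)%N.
Proof.
by move=> nu; apply: depth_uniq; rewrite (ancestorD _ nu) ancestor_depth.
Qed.

End Tree.

(** * Iterates of the backward shift *)

Section Shift.
Context {R : realType} {k : scalar_kind} {V : countType}.
Variables (E : rel V) (mu : weight R k V) (s : space_kind R).
Local Notation K := (scalars R k).
Local Notation X := (wspace mu s).
Local Notation N := (space_norm mu s).
Variable B : {linear X -> X}.
Hypothesis treeE : directed_tree E.
Hypothesis shiftB : is_backward_shift E B.

Definition odelta (o : option V) : X := oapp (delta mu s) 0 o.

Lemma odeltaE o v : odelta o v = (o == Some v)%:R.
Proof. by case: o => //= u; rewrite eq_sym. Qed.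

(** At [v], the sums over finite sets of children are eventually constant: 1 once the set contains
    [u], or always 0 if [u] is not a child of [v]. Limits being unique, this determines [B]. *)
Lemma shift_delta u : B (delta mu s u) = odelta (parent E u).
Proof.
apply: wspaceP => v; rewrite odeltaE parentP//.
have := @shiftB (delta mu s u) v.
set ps := summability.partial_sum _ => cvps.
have tf : ProperFilter summability.totally :=
  @summability.totally_filter {u : V | u \in Chi E v}.
have cvc : ps @ summability.totally --> ((E v u)%:R : K).
  apply: (@cvg_near_cst _ _ _ ps _ tf).
  have [Evu|nEvu] := boolP (E v u); last first.
    exists fset0 => // A _; rewrite /= /ps /summability.partial_sum big1// => i _.
    rewrite /=; case: eqP => // iu.
    have : sval (fsval i) \in Chi E v := valP (fsval i).
    by rewrite iu inE (negbTE nEvu).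
  have uP : u \in Chi E v by rewrite inE.
  exists [fset exist _ u uP]%fset => //= A /= uA.
  have {}uA : exist (fun u => u \in Chi E v) u uP \in A.
    by apply: (fsubsetP uA); rewrite inE.
  rewrite /ps /summability.partial_sum (bigD1 [` uA]%fset)//= eqxx.
  rewrite big1 ?addr0// => i ni; rewrite /=; case: eqP => // iu.
  by case/negP: ni; apply/eqP/val_inj/val_inj; exact: iu.
exact: (cvg_unique _ cvps cvc).
Qed.

Lemma iter_shiftD n (x y : X) : iter n B (x + y) = iter n B x + iter n B y.
Proof. by elim: n => //= n ->; rewrite linearD. Qed.

Lemma iter_shiftZ n (a : K) (x : X) : iter n B (a *: x) = a *: iter n B x.
Proof. by elim: n => //= n ->; rewrite linearZ. Qed.

Lemma iter_shiftB n (x y : X) : iter n B (x - y) = iter n B x - iter n B y.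
Proof. by rewrite -scaleN1r iter_shiftD iter_shiftZ scaleN1r. Qed.

Lemma iter_shift0 n : iter n B 0 = 0.
Proof. by elim: n => //= n ->; rewrite linear0. Qed.

Lemma iter_shift_sum n (I : Type) (t : seq I) (P : pred I) (F : I -> X) :
  iter n B (\sum_(i <- t | P i) F i) = \sum_(i <- t | P i) iter n B (F i).
Proof.
by apply: (big_morph (iter n B)) => [x y|]; [exact: iter_shiftD|exact: iter_shift0].
Qed.

Lemma iter_shift_delta n u : iter n B (delta mu s u) = odelta (ancestor E n u).
Proof.
elim: n => //= n ->; rewrite /ancestor/=.
by case: (iter n _ _) => [v|] /=; rewrite ?shift_delta ?linear0.
Qed.

Lemma iter_shift_lincomb n (t : seq (V * K)) :
  iter n B (lincomb mu s t) = \sum_(p <- t) p.2 *: odelta (ancestor E n p.1).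
Proof.
rewrite iter_shift_sum; apply: eq_bigr => p _.
by rewrite iter_shiftZ iter_shift_delta.
Qed.

(** Adding 1 to the modulus of the given bound makes the powers of the constant non-decreasing. *)
Lemma shift_norm_bound : bounded_operator B ->
  exists2 M : R, 1 <= M & forall n x, N (iter n B x) <= M ^+ n * N x.
Proof.
move=> [M HM]; exists (1 + modulus M); first by rewrite lerDl modulus_ge0.
have BM x : N (B x) <= (1 + modulus M) * N x.
  apply: (@le_trans _ _ (modulus M * N x)); last first.
    by rewrite ler_wpM2r ?space_norm_ge0// lerDr.
  (* The scalar on the right dominates a norm, so it is non-negative and equals its own absolute
     value. *)
  have BMx := HM x; have Mx0 : 0 <= M * `|x| := le_trans (normr_ge0 _) BMx.
  move: BMx; rewrite -(ger0_norm Mx0) normrM normr_id normE !space_normE.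
  by rewrite -of_realM ler_of_real.
elim=> [|n IHn] x; first by rewrite expr0 mul1r.
rewrite iterS; apply: le_trans (BM _) _; rewrite exprS -mulrA ler_wpM2l ?IHn//.
by rewrite addr_ge0 ?modulus_ge0.
Qed.

End Shift.

(** * Algebra of finite linear combinations *)

Section LinComb.
Context {R : realType} {k : scalar_kind} {V : countType}.
Variables (mu : weight R k V) (s : space_kind R).
Local Notation K := (scalars R k).
Implicit Types t : seq (V * K).

Lemma lincomb_nil : lincomb mu s [::] = 0.
Proof. exact: big_nil. Qed.

Lemma lincomb_cons p t :
  lincomb mu s (p :: t) = p.2 *: delta mu s p.1 + lincomb mu s t.
Proof. exact: big_cons. Qed.

Lemma lincomb_cat t1 t2 :
  lincomb mu s (t1 ++ t2) = lincomb mu s t1 + lincomb mu s t2.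
Proof. exact: big_cat. Qed.

Lemma lincombZ (a : K) t :
  lincomb mu s [seq (p.1, a * p.2) | p <- t] = a *: lincomb mu s t.
Proof.
rewrite /lincomb big_map scaler_sumr; apply: eq_bigr => p _.
by rewrite scalerA.
Qed.

Lemma lincomb_eq0 t v : (forall p, p \in t -> p.1 != v) ->
  lincomb mu s t v = 0.
Proof.
move=> tv; rewrite /lincomb wspace_sum big_seq big1// => p /tv pv.
by rewrite wspaceZ deltaE eq_sym (negbTE pv) mulr0.
Qed.

End LinComb.

(** * Small preimages of finitely supported vectors *)

Section Shrinking.
Context {R : realType} {k : scalar_kind} {V : countType}.
Variables (E : rel V) (mu : weight R k V) (s : space_kind R).
Local Notation K := (scalars R k).
Local Notation X := (wspace mu s).
Local Notation N := (space_norm mu s).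
Local Notation lincomb := (lincomb mu s).
Local Notation delta := (delta mu s).
Variable B : {linear X -> X}.
Hypothesis treeE : directed_tree E.
Hypothesis shiftB : is_backward_shift E B.
Variable r : V.
Hypothesis root_r : is_root E r.
Variable M : R.
Hypothesis M1 : 1 <= M.
Hypothesis normB : forall n (x : X), N (iter n B x) <= M ^+ n * N x.
Local Notation depth := (depth treeE root_r).

Let Mn_gt0 n : 0 < M ^+ n.
Proof. by rewrite exprn_gt0// (lt_le_trans ltr01). Qed.

Let mu_gt0 v : 0 < modulus (mu v).
Proof. exact: modulus_gt0 (weight_neq0 mu v). Qed.

Lemma modulus_iter_shift n (x : X) v :
  modulus (iter n B x v) * modulus (mu v) <= M ^+ n * N x.
Proof. exact: le_trans (coordinate_le_norm v (in_spaceP _)) (normB n x). Qed.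

Definition shrinking : Prop := forall (F : seq V) (e : R), 0 < e ->
  exists n, exists2 phi : X, N phi <= e &
    forall v, v \in F -> 1 <= modulus (iter n B phi v).

(** Beyond the largest depth in the list, no vertex has an [n]-th ancestor. *)
Lemma lincomb_nilpotent t : exists n0, forall n, (n0 <= n)%N ->
  iter n B (lincomb t) = 0.
Proof.
elim: t => [|p t [n0 IHt]].
  by exists 0%N => n _; rewrite lincomb_nil iter_shift0.
exists (maxn n0 (depth p.1).+1) => n; rewrite geq_max => /andP[nn0 pn].
rewrite lincomb_cons iter_shiftD iter_shiftZ IHt//.
rewrite (iter_shift_delta treeE shiftB).
by rewrite (ancestor_gt_depth pn)//= scaler0 addr0.
Qed.

(** Cut [phi] down to finitely many vertices of the [n]-th generation below [v], then divide by the
    value [lam] produced at [v]. Truncation keeps its modulus at least 1/2, whence the factor 2. *)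
Lemma delta_preimage n (phi : X) v : 1 <= modulus (iter n B phi v) ->
  exists t, [/\ iter n B (lincomb t) = delta v, N (lincomb t) <= 2 * N phi &
    forall p, p \in t -> ancestor E n p.1 = Some v].
Proof.
(* An error of this size in [phi] changes the value of the [n]-th iterate at [v] by at most 1/2. *)
move=> phi1; have e0 : 0 < modulus (mu v) / (2 * M ^+ n).
  by rewrite divr_gt0// mulr_gt0.
have [F HF] := space_norm_tail (in_spaceP phi) e0.
pose y := lincomb [seq (u, phi u) | u <- F].
have {HF} phiy : N (phi - y) <= modulus (mu v) / (2 * M ^+ n).
  apply: le_trans HF; apply: space_norm_le.
    move=> u; rewrite wspaceB lincomb_fset.
    by case: ifP => _; rewrite ?subrr ?subr0.
  apply: in_space_le (in_spaceP phi) => u; case: ifP => // _.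
  by rewrite modulus0 modulus_ge0.
pose lam := iter n B y v.
have lam2 : 2^-1 <= modulus lam.
  have h : modulus (iter n B (phi - y) v) <= 2^-1.
    rewrite -(ler_pM2r (mu_gt0 v)); apply: le_trans (modulus_iter_shift _ _ _) _.
    rewrite -ler_pdivlMl//; apply: le_trans phiy _.
    by rewrite le_eqVlt; apply/orP; left; apply/eqP; rewrite invfM; lra.
  have := ler_modulusB (iter n B phi v) (iter n B (phi - y) v).
  rewrite iter_shiftB wspaceB -/lam subKr => h2.
  by rewrite iter_shiftB wspaceB -/lam in h; lra.
pose F' := [fset u in F | ancestor E n u == Some v]%fset.
have lamE : lam = \sum_(u <- F') phi u.
  rewrite /lam /y (iter_shift_lincomb treeE shiftB) wspace_sum big_map big_fset.
  rewrite [RHS]big_mkcond; apply: eq_bigr => u _.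
  by rewrite wspaceZ odeltaE; case: eqP => _; rewrite ?mulr1 ?mulr0.
have lam0 : lam != 0.
  by apply: contraTneq lam2 => ->; rewrite modulus0 -ltNge invr_gt0.
exists [seq (u, lam^-1 * phi u) | u <- F']; split.
- rewrite (iter_shift_lincomb treeE shiftB) big_map.
  rewrite big_seq (eq_bigr (fun u => (lam^-1 * phi u) *: delta v)).
    by rewrite -big_seq -scaler_suml -mulr_sumr -lamE mulVf// scale1r.
  by move=> u; rewrite !inE => /andP[_ /eqP ->].
- apply: (@le_trans _ _ (N (lam^-1 *: phi))).
    apply: space_norm_le (in_spaceP _) => u.
    rewrite (lincomb_fset mu s F' (fun u => lam^-1 * phi u)) wspaceZ.
    by case: ifP => // _; rewrite modulus0 modulus_ge0.
  rewrite wnormZ modulusV ler_wpM2r ?space_norm_ge0//.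
  by rewrite -[leRHS]invrK lef_pV2 ?posrE// modulus_gt0.
- by move=> p /mapP[u]; rewrite !inE => /andP[_ /eqP ua] ->.
Qed.

(** One [phi] serves all vertices of [t], so the preimages of the basis vectors share the same [n]
    and can be combined linearly. The root joins the list to make [n] large. *)
Lemma shrinking_preimage t n0 (e : R) : shrinking -> 0 < e ->
  exists2 n, (n0 <= n)%N & exists t',
    [/\ iter n B (lincomb t') = lincomb t, N (lincomb t') <= e &
      forall p, p \in t' -> (n <= depth p.1)%N].
Proof.
move=> shr e0; pose c := \sum_(p <- t) modulus p.2.
have c0 : 0 <= c by apply: sumr_ge0 => p _; exact: modulus_ge0.
(* The first bound makes the final norm, at most [2 * e' * c], smaller than [e], with [c + 1]
   guarding against [c = 0]; the second forces [n0 <= n]. *)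
pose e' := Num.min (e / (2 * (c + 1))) (modulus (mu r) / (2 * M ^+ n0)).
have c1 : 0 < 2 * (c + 1) by lra.
have e'0 : 0 < e' by rewrite lt_min !divr_gt0// mulr_gt0.
have [n [phi phie Hphi]] := shr (r :: [seq p.1 | p <- t]) e' e'0.
exists n.
  (* Otherwise phi would be too small for |(B^n phi)(root)| >= 1. *)
  rewrite leqNgt; apply/negP => nn0.
  have := modulus_iter_shift n phi r; apply/negP; rewrite -ltNge.
  apply: (@lt_le_trans _ _ (modulus (mu r))); last first.
    by rewrite ler_peMl ?modulus_ge0// Hphi// mem_head.
  apply: (@le_lt_trans _ _ (M ^+ n0 * e')).
    apply: ler_pM phie; first exact: ltW.
      exact: space_norm_ge0.
    by rewrite ler_weXn2l// ltnW.
  apply: (@le_lt_trans _ _ (modulus (mu r) / 2)); last first.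
    by have := mu_gt0 r; lra.
  rewrite -ler_pdivlMl// ge_min; apply/orP; right.
  by rewrite invfM mulrA [_^-1 * _]mulrC.
suff [t' [h1 h2 h3]] : exists t', [/\ iter n B (lincomb t') = lincomb t,
    N (lincomb t') <= 2 * e' * c & forall p, p \in t' -> (n <= depth p.1)%N].
  exists t'; split=> //; apply: le_trans h2 _.
  apply: (@le_trans _ _ (2 * e' * (c + 1))); first by rewrite ler_wpM2l; lra.
  have : e' <= e / (2 * (c + 1)) by rewrite ge_min lexx.
  by rewrite ler_pdivlMr// => h; lra.
have : forall p, p \in t -> 1 <= modulus (iter n B phi p.1).
  by move=> p pt; apply: Hphi; rewrite inE map_f// orbT.
(* The value of [e'] depends on [t]; it is forgotten so that [e'] stays fixed during the
   induction. *)
clearbody e'; rewrite /c {c c0 Hphi c1}; elim: t => [|p t IHt] Hp.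
  by exists [::]; rewrite lincomb_nil iter_shift0 wnorm0 big_nil mulr0.
have [q qt|t' [h1 h2 h3]] := IHt; first by apply: Hp; rewrite inE qt orbT.
have [t1 [k1 k2 k3]] := delta_preimage (Hp p (mem_head _ _)).
exists ([seq (q.1, p.2 * q.2) | q <- t1] ++ t'); split.
- by rewrite lincomb_cat lincombZ iter_shiftD iter_shiftZ h1 k1 lincomb_cons.
- rewrite lincomb_cat lincombZ big_cons mulrDr.
  apply: le_trans (wnormD _ _) _; apply: lerD => //.
  rewrite wnormZ mulrC ler_wpM2r ?modulus_ge0//; apply: le_trans k2 _.
  by rewrite ler_wpM2l.
- move=> q; rewrite mem_cat => /orP[/mapP[q1 /k3 qv ->]|/h3//] /=.
  by rewrite (depth_ancestor treeE root_r qv) leq_addl.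
Qed.

End Shrinking.

(** * Limits of eventually stationary sequences *)

Section Limit.
Context {R : realType} {k : scalar_kind} {V : countType}.
Variables (mu : weight R k V) (s : space_kind R).
Local Notation K := (scalars R k).
Local Notation X := (wspace mu s).
Local Notation N := (space_norm mu s).

(** The bounds defining [in_ball] each involve finitely many coordinates only. *)
Lemma in_ball_local (f : V -> K) (M : R) :
  (forall F : {fset V}, exists2 g : V -> K,
    in_ball mu s g M & forall v, v \in F -> g v = f v) ->
  in_ball mu s f M.
Proof.
rewrite /in_ball; case: s => [p p1|] H => [F|v].
  have [g gM gf] := H F; apply: le_trans (gM F).
  by rewrite le_eqVlt; apply/orP; left; apply/eqP/eq_big_seq => v /gf ->.
by have [g gM <-] := H [fset v]%fset; rewrite ?gM// inE.
Qed.

(* A completeness statement that spares the completeness of the scalars: the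
   partial sums below are eventually constant at each vertex. *)
Lemma wspace_limit (S : nat -> X) (f : V -> K) (a : nat -> R) :
  (forall v, exists m0, forall m, (m0 <= m)%N -> S m v = f v) ->
  (forall j m, (j <= m)%N -> N (S m - S j) <= a j) ->
  (forall e, 0 < e -> exists j, a j < e) ->
  exists g : X, forall j, N (g - S j) <= a j.
Proof.
move=> Sf Sa a0; have a_ge0 j : 0 <= a j.
  by apply: le_trans (Sa j j (leqnn j)); exact: space_norm_ge0.
have ballj j : in_ball mu s (f - S j) (a j).
  apply: in_ball_local => F.
  have [m0 Hm0] : exists m0, forall m v, v \in (F : seq V) -> (m0 <= m)%N -> S m v = f v.
    elim: (F : seq V) => [|v t [m1 H1]]; first by exists 0%N.
    have [m2 H2] := Sf v; exists (maxn m1 m2) => m w.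
    rewrite inE geq_max => /orP[/eqP ->|wt] /andP[mm1 mm2]; first exact: H2.
    exact: H1.
  (* On [F] this vector already coincides with [f - S j]. *)
  exists (S (maxn m0 j) - S j : X).
    apply/space_norm_leP => //; [exact: in_spaceP|exact: Sa _ _ (leq_maxr _ _)].
  by move=> v vF; rewrite wspaceB Hm0// leq_maxl.
suff sf j : in_space mu s (f - S j).
  have [g gE] : exists g : X, g =1 f.
    apply: wspaceE; rewrite -(subrK (S 0%N : V -> K) f).
    by apply: in_spaceD (sf 0%N) (in_spaceP _).
  have {}gE : (g : V -> K) = f by apply/funext.
  exists g => j; apply/space_norm_leP => //; first exact: in_spaceP.
  by rewrite -gE in ballj; exact: ballj.
move: Sf Sa ballj; rewrite /in_ball; case: s S => [p p1|] S Sf Sa ballj /=.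
  apply: (@le_lt_trans _ _ (a j `^ p)%:E); last exact: ltry.
  by apply/esum_leP; exact: ballj.
(* Vanishing at infinity comes from splitting [f - S j] into [f - S i], uniformly below [e / 2], and
   [S i - S j], which lies in the space. *)
move=> e e0; have [i ai] := a0 (e / 2) (divr_gt0 e0 (ltr0Sn _ 1)).
have [F finF HF] := in_spaceP (S i - S j) _ (divr_gt0 e0 (ltr0Sn _ 1)).
exists F => // v /HF vF.
rewrite -(subrK (S i : V -> K) f) -addrA fctE mulrDl.
apply: le_lt_trans (ler_modulusD _ _) _; rewrite [ltRHS]splitr ltr_leD//.
  exact: le_lt_trans (ballj i v) ai.
exact: ltW.
Qed.

End Limit.

(** * A countable dense family of finitely supported vectors *)

Section Separability.
Context {R : realType} {k : scalar_kind} {V : countType}.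
Variables (mu : weight R k V) (s : space_kind R).
Local Notation K := (scalars R k).
Local Notation X := (wspace mu s).
Local Notation N := (space_norm mu s).

Lemma rat_approx (a e : R) : 0 < e -> exists q : rat, `|ratr q - a| < e.
Proof.
move=> e0; have [|q] := @rat_in_itvoo R (a - e) (a + e); first by lra.
rewrite in_itv/= => /andP[q1 q2]; exists q.
by rewrite ltr_norml; apply/andP; split; lra.
Qed.

Lemma scalars_separable : exists d : nat -> K, forall z e, 0 < e ->
  exists n, modulus (d n - z) < e.
Proof.
suff [T [d Hd]] : exists (T : countType) (d : T -> K), forall z e, 0 < e ->
    exists n, modulus (d n - z) < e.
  exists (fun n => oapp d 0 (choice.unpickle n)) => z e /(Hd z)[x xz].
  by exists (choice.pickle x); rewrite choice.pickleK.
case: k => /=; first by exists rat, ratr => a e; exact: rat_approx.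
exists (rat * rat)%type, (fun q => ((ratr q.1) +i* (ratr q.2))%C).
move=> [a b] e e0; have e20 : 0 < e / 2 by rewrite divr_gt0.
have [p pa] := rat_approx a e20; have [q qb] := rat_approx b e20.
exists (p, q) => /=.
apply: (@le_lt_trans _ _ (`|ratr p - a| + `|ratr q - b|)); last first.
  by rewrite [ltRHS]splitr ltrD.
rewrite -[leRHS]ger0_norm ?addr_ge0// -sqrtr_sqr ler_wsqrtr// [leRHS]sqrrD.
by rewrite !real_normK ?num_real// lerD2r lerDl mulrn_wge0// mulr_ge0.
Qed.

(** Indices encode pairs of a dummy integer and a list, so each list recurs at arbitrarily large
    indices. The hypercyclic vector relies on this, its errors being small only for large [j]. *)
Lemma lincomb_separable : exists y : nat -> seq (V * K),
  forall (x : X) e j0, 0 < e ->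
    exists2 j, (j0 <= j)%N & N (lincomb mu s (y j) - x) < e.
Proof.
have [d Hd] := scalars_separable.
pose c (q : seq (V * nat)) : seq (V * K) := [seq (p.1, d p.2) | p <- q].
have dense_c (x : X) e : 0 < e -> exists q, N (lincomb mu s (c q) - x) < e.
  move=> e0; have e20 : 0 < e / 2 by rewrite divr_gt0.
  have [t tx] := dense_lincomb x e20.
  suff [q qt] : exists q, N (lincomb mu s (c q) - lincomb mu s t) < e / 2.
    exists q; apply: le_lt_trans (wnorm_triangle (lincomb mu s t) _ _) _.
    by rewrite [ltRHS]splitr ltrD// wnormB.
  elim: t (e / 2) e20 {tx} => [|p t IHt] e' e'0.
    by exists [::]; rewrite subrr wnorm0.
  have e'20 : 0 < e' / 2 by rewrite divr_gt0.
  have [q qt] := IHt _ e'20.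
  have D0 : 0 < N (delta mu s p.1) + 1 by rewrite ltr_wpDl ?space_norm_ge0.
  have [n np] := Hd p.2 _ (divr_gt0 e'20 D0).
  exists ((p.1, n) :: q).
  rewrite (lincomb_cons _ _ (p.1, d n) (c q)) lincomb_cons opprD addrACA.
  rewrite -scalerBl; apply: le_lt_trans (wnormD _ _) _.
  rewrite [ltRHS]splitr ler_ltD// wnormZ.
  move: np; rewrite ltr_pdivlMr// => /ltW; apply: le_trans.
  by rewrite ler_wpM2l ?modulus_ge0// lerDl.
pose T := (nat * seq (V * nat))%type.
exists (fun j => c (oapp snd [::] (choice.unpickle j : option T))) => x e j0 e0.
have [q qx] := dense_c x e e0.
have [m mj] : exists m : nat, (j0 <= choice.pickle ((m, q) : T))%N.
  (* Otherwise [j0.+1] distinct codes would lie below [j0]. *)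
  apply: contrapT => /forallNP H.
  have ltj0 m : (choice.pickle ((m, q) : T) < j0)%N by have /negP := H m; rewrite -ltnNge.
  pose h (m : 'I_j0.+1) := Ordinal (ltj0 m).
  have : injective h.
    by move=> m1 m2 /(congr1 val)/= /(pcan_inj choice.pickleK)[] /val_inj.
  by move=> /leq_card; rewrite !card_ord ltnn.
by exists (choice.pickle ((m, q) : T)) => //; rewrite choice.pickleK.
Qed.

End Separability.

(** * From small preimages to hypercyclicity and recurrence *)

Lemma half_step (F : realFieldType) (a z : F) :
  a - 2^-1 * z = 2^-1 * z + (a - z).
Proof. by lra. Qed.

Section Hypercyclicity.
Context {R : realType} {k : scalar_kind} {V : countType}.
Variables (E : rel V) (mu : weight R k V) (s : space_kind R).
Local Notation K := (scalars R k).
Local Notation X := (wspace mu s).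
Local Notation N := (space_norm mu s).
Local Notation lincomb := (lincomb mu s).
Variable B : {linear X -> X}.
Hypothesis treeE : directed_tree E.
Hypothesis shiftB : is_backward_shift E B.
Variable r : V.
Hypothesis root_r : is_root E r.
Variable M : R.
Hypothesis M1 : 1 <= M.
Hypothesis normB : forall n (x : X), N (iter n B x) <= M ^+ n * N x.
Hypothesis shr : shrinking B.
Local Notation depth := (depth treeE root_r).

Let Mn_gt0 n : 0 < M ^+ n.
Proof. by rewrite exprn_gt0// (lt_le_trans ltr01). Qed.

(** Append to [t] a small preimage of [y] under an iterate high enough to kill [t]. The new vertices
    have depth at least [st.2], so shallower coordinates are unchanged. *)
Lemma hypercyclic_step (t y : seq (V * K)) (n : nat) (e : R) : 0 < e ->
  exists st : seq (V * K) * nat, [/\ (n < st.2)%N,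
    iter st.2 B (lincomb st.1) = lincomb y,
    N (lincomb st.1 - lincomb t) <= e &
    forall v, (depth v < st.2)%N -> lincomb st.1 v = lincomb t v].
Proof.
move=> e0; have [n0 Hn0] := lincomb_nilpotent treeE shiftB root_r t.
have [n' + [t' [h1 h2 h3]]] :=
  shrinking_preimage treeE shiftB root_r M1 normB y (maxn n0 n.+1) shr e0.
rewrite geq_max => /andP[n0n' nn']; exists (t ++ t', n'); split=> //=.
- by rewrite lincomb_cat iter_shiftD Hn0// add0r h1.
- by rewrite lincomb_cat addrC addKr.
- move=> v vn'; rewrite lincomb_cat wspaceD (@lincomb_eq0 _ _ _ _ _ t') ?addr0//.
  by move=> p /h3 pn'; apply: contraTneq pn' => ->; rewrite -ltnNge.
Qed.

Lemma half_pow_lt (e : R) : 0 < e -> exists j0, forall j, (j0 <= j)%N ->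
  2^-1 ^+ j < e.
Proof.
move=> e0; exists (Num.bound e^-1) => j jb.
rewrite exprVn invf_plt ?posrE ?exprn_gt0//.
exact: upper_nthrootP.
Qed.

Lemma shrinking_hypercyclic : hypercyclic B.
Proof.
have [y Hy] := lincomb_separable mu s.
have a_gt0 (j n : nat) : 0 < 2^-1 ^+ j / M ^+ n.
  by rewrite divr_gt0// exprn_gt0// invr_gt0.
have /choice[F HF] : forall x : nat * (seq (V * K) * nat), exists st,
    [/\ (x.2.2 < st.2)%N, iter st.2 B (lincomb st.1) = lincomb (y x.1),
      N (lincomb st.1 - lincomb x.2.1) <= 2^-1 ^+ x.1.+1 / M ^+ x.2.2 &
      forall v, (depth v < st.2)%N -> lincomb st.1 v = lincomb x.2.1 v].
  by move=> x; exact: hypercyclic_step.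
pose fix st (j : nat) : seq (V * K) * nat :=
  if j is i.+1 then F (i, st i) else ([::], 0%N).
pose S j := lincomb (st j).1; pose n j := (st j).2.
have Hst j : [/\ (n j < n j.+1)%N, iter (n j.+1) B (S j.+1) = lincomb (y j),
    N (S j.+1 - S j) <= 2^-1 ^+ j.+1 / M ^+ n j &
    forall v, (depth v < n j.+1)%N -> S j.+1 v = S j v].
  exact: HF (j, st j).
have n_homo : {homo n : i j / (i <= j)%N}.
  by apply: homo_leq => [//|i j l|j]; [exact: leq_trans|case: (Hst j) => /ltnW].
have n_ge j : (j <= n j)%N.
  by elim: j => // j IHj; case: (Hst j) => nj _ _ _; exact: leq_ltn_trans nj.
(* The geometric sum is kept in closed form for the induction on [d]; later steps carry even larger
   powers of [M] in their denominators. *)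
have SB j d : N (S (j + d)%N - S j) <= (2^-1 ^+ j - 2^-1 ^+ (j + d)) / M ^+ n j.
  elim: d => [|d IHd]; first by rewrite addn0 !subrr wnorm0 mul0r.
  apply: le_trans (wnorm_triangle (S (j + d)%N) _ _) _.
  have -> : (2^-1 ^+ j - 2^-1 ^+ (j + d.+1)) / M ^+ n j =
      2^-1 ^+ (j + d).+1 / M ^+ n j + (2^-1 ^+ j - 2^-1 ^+ (j + d)) / M ^+ n j.
    rewrite -mulrDl addnS exprS; congr (_ / _).
    exact: half_step.
  apply: lerD IHd; rewrite addnS; case: (Hst (j + d)%N) => _ _ h _.
  apply: le_trans h _; rewrite ler_wpM2l ?exprn_ge0 ?invr_ge0//.
  by rewrite lef_pV2 ?posrE// ler_weXn2l// n_homo// leq_addr.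
have [g Hg] : exists g : X, forall j, N (g - S j) <= 2^-1 ^+ j / M ^+ n j.
  (* Since [j <= n j], the coordinate at [v] no longer changes from the index [(depth v).+1] on. *)
  apply: (@wspace_limit _ _ _ _ _ S (fun v => S (depth v).+1 v)).
  - move=> v; exists (depth v).+1; elim=> // m IHm.
    rewrite leq_eqVlt => /predU1P[->//|]; rewrite ltnS => vm.
    rewrite -IHm//; case: (Hst m) => _ _ _; apply.
    by apply: (leq_trans vm); apply: leq_trans (leqnSn m) (n_ge _).
  - move=> i m /subnKC <-; apply: le_trans (SB _ _) _.
    by rewrite ler_wpM2r ?invr_ge0 1?ltW// ltrBlDr ltrDl exprn_gt0// invr_gt0.
  - move=> e /half_pow_lt[j0 Hj0]; exists j0; apply: le_lt_trans (Hj0 _ (leqnn _)).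
    by rewrite ler_pdivrMr// ler_peMr ?exprn_ge0 ?invr_ge0// exprn_ege1.
exists g => O [x Ox] oO; have [e e0 He] := wopen_ball oO Ox.
have e20 : 0 < e / 2 by rewrite divr_gt0.
have [j0 Hj0] := half_pow_lt e20; have [j jj0 yj] := Hy x (e / 2) j0 e20.
exists (iter (n j.+1) B g); split; last by exists (n j.+1).
apply: He; apply: le_lt_trans (wnorm_triangle (lincomb (y j)) _ _) _.
rewrite [ltRHS]splitr ltrD//; case: (Hst j) => _ <- _ _.
(* The factor [M ^+ n j.+1] lost here cancels the denominator in [Hg]. *)
rewrite -iter_shiftB; apply: le_lt_trans (normB _ _) _.
apply: le_lt_trans (Hj0 j.+1 (leqW jj0)).
by rewrite -ler_pdivlMl// mulrC.
Qed.

(** Take a finitely supported [lincomb t] near [g] and apply the step above with [t] as both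
    starting point and target: a vector near [g] is mapped exactly onto [lincomb t]. *)
Lemma shrinking_weakly_recurrent (g : X) (U W : set X) :
  open_nbhs g U -> weakly_open_nbhs g W ->
  exists2 n : nat, (1 <= n)%N & (iter n B @` U) `&` W !=set0.
Proof.
move=> [oU Ug] [/weakly_open_open oW Wg].
have [e1 e10 H1] := wopen_ball oU Ug; have [e2 e20 H2] := wopen_ball oW Wg.
pose e := Num.min (e1 / 2) e2.
have e0 : 0 < e by rewrite lt_min e20 divr_gt0.
have [t gt] := dense_lincomb g e0; rewrite wnormB in gt.
have e120 : 0 < e1 / 2 by rewrite divr_gt0.
have [st [n0 h1 h2 _]] := hypercyclic_step t t 0 e120.
exists st.2 => //; exists (lincomb t); split.
  exists (lincomb st.1) => //; apply: H1.
  apply: le_lt_trans (wnorm_triangle (lincomb t) _ _) _.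
  by rewrite [ltRHS]splitr ler_ltD//; move: gt; rewrite lt_min => /andP[].
by apply: H2; move: gt; rewrite lt_min => /andP[].
Qed.

End Hypercyclicity.

(** * From weak density or recurrence to small vectors with large iterates *)

Section Necessity.
Context {R : realType} {k : scalar_kind} {V : countType}.
Variables (E : rel V) (mu : weight R k V) (s : space_kind R).
Local Notation K := (scalars R k).
Local Notation X := (wspace mu s).
Local Notation N := (space_norm mu s).
Local Notation lincomb := (lincomb mu s).
Variable B : {linear X -> X}.

Lemma weakly_open_nbhs_coordinate (F : seq V) (g : X) (e : R) : 0 < e ->
  weakly_open_nbhs g [set x | forall v, v \in F -> modulus (x v - g v) < e].
Proof.
move=> e0; have ballE v : [set z : K^o | modulus (z - g v) < e] =
    ball (g v : K^o) (of_real e).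
  rewrite -ball_normE; apply/seteqP; split=> z /=;
  by rewrite distrC normE ltr_of_real.
split; last by move=> v _; rewrite subrr modulus0.
apply: (@open_weak_bigI _ _ _ F (fun v => coordinate v : {linear X -> K^o})
  (fun v => [set z : K^o | modulus (z - g v) < e])) => v.
  exact: continuous_coordinate.
by rewrite ballE; exact: ball_open.
Qed.

Lemma bounded_orb_shrinking (C : set X) :
  bounded_set C -> weakly_dense (Orb B C) -> shrinking B.
Proof.
move=> /pinfty_ex_gt0[M M0 CM] dC F e e0.
have m0 : 0 < modulus M by rewrite -(@ltr_of_real R k) -gt0_of_real// of_real0.
(* An iterate within 1 of the value [c + 1] on [F] has modulus at least [c] there; dividing [f] by
   [c] brings its norm down to at most [e]. *)
pose c := modulus M / e; have c0 : 0 < c by rewrite divr_gt0.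
pose F' := [fset v in F]%fset.
pose g := lincomb [seq (u, of_real (c + 1)) | u <- F'].
have gE v : v \in F -> g v = of_real (c + 1).
  by move=> vF; rewrite (lincomb_fset mu s F' (fun=> of_real (c + 1))) !inE vF.
have [oW Wg] := weakly_open_nbhs_coordinate F g ltr01.
have [x [Wx [n _ [f Cf fx]]]] := dC _ (ex_intro _ g Wg) oW.
rewrite -{}fx in Wx.
exists n, (of_real c^-1 *: f).
  have Nf : N f <= modulus M.
    by rewrite -(@ler_of_real R k) -space_normE -gt0_of_real//; exact: CM.
  rewrite wnormZ modulus_of_real gtr0_norm ?invr_gt0// ler_pdivrMl//.
  by rewrite /c divfK// gt_eqF.
move=> v vF; rewrite iter_shiftZ wspaceZ modulusM modulus_of_real.
rewrite gtr0_norm ?invr_gt0// ler_pdivlMl// mulr1.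
have := Wx v vF; rewrite gE// => h.
have := ler_modulusB (of_real (c + 1) : K) (of_real (c + 1) - iter n B f v).
rewrite subKr -(modulusN (_ - iter n B f v)) opprB modulus_of_real.
by rewrite gtr0_norm ?addr_gt0// => h'; lra.
Qed.

Hypothesis treeE : directed_tree E.
Hypothesis shiftB : is_backward_shift E B.
Variable r : V.
Hypothesis root_r : is_root E r.
Local Notation depth := (depth treeE root_r).

Lemma weakly_recurrent_shrinking :
  (forall (g : X) (U W : set X), open_nbhs g U -> weakly_open_nbhs g W ->
    exists2 n : nat, (1 <= n)%N & (iter n B @` U) `&` W !=set0) ->
  shrinking B.
Proof.
move=> rec F e e0; pose F' := [fset v in F]%fset.
(* With this base, [size F'] terms of size at most [w v / b] add up to at most [w v / 2]. *)
pose b : R := (2 * (size F').+1)%:R.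
have b0 : 0 < b by rewrite ltr0n muln_gt0.
have b1 : b^-1 <= 1 by rewrite invf_le1// ler1n muln_gt0.
pose w v := b^-1 ^+ depth v.
have w0 v : 0 < w v by rewrite exprn_gt0// invr_gt0.
pose c := b^-1 ^+ (\max_(v <- F) depth v).
have c0 : 0 < c by rewrite exprn_gt0// invr_gt0.
have cw v : v \in F -> c <= w v.
  move=> vF; rewrite /c /w ler_wiXn2l ?invr_ge0 ?(ltW b0)//.
  exact: leq_bigmax_seq.
(* On [F] the iterate of [f - g] has modulus at least [w v - d - w v / 2], hence at least [c / 4].
   The rescaling by [4 / c] explains the second bound. *)
pose d := Num.min (c / 4) (e * c / 4).
have d0 : 0 < d by rewrite lt_min !divr_gt0// mulr_gt0.
have dc : d <= c / 4 by rewrite ge_min lexx.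
have de : d <= e * c / 4 by rewrite ge_min lexx orbT.
pose g := lincomb [seq (u, of_real (w u)) | u <- F'].
have gE v : v \in F -> g v = of_real (w v).
  by move=> vF; rewrite (lincomb_fset mu s F' (fun u => of_real (w u))) !inE vF.
have [n n1 [y [[f Uf fy] Wf]]] :=
  rec g _ _ (open_nbhs_wball g d0) (weakly_open_nbhs_coordinate F g d0).
rewrite -{}fy in Wf.
exists n, (of_real (4 / c) *: (f - g)).
  rewrite wnormZ modulus_of_real gtr0_norm ?divr_gt0//.
  rewrite -ler_pdivlMl ?divr_gt0// invf_div; apply: le_trans (ltW Uf) _.
  by rewrite mulrC mulrA.
move=> v vF; rewrite iter_shiftZ wspaceZ modulusM modulus_of_real.
rewrite gtr0_norm ?divr_gt0// -ler_pdivrMl ?divr_gt0// mulr1 invf_div.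
(* Only vertices [n] generations below [v] contribute, and [1 <= n] makes each of their weights at
   most [b^-1 * w v]. *)
have Bg : modulus (iter n B g v) <= w v / 2.
  rewrite (iter_shift_lincomb treeE shiftB) wspace_sum big_map.
  apply: le_trans (modulus_sum _ _ _) _.
  apply: (@le_trans _ _ (\sum_(u <- F') b^-1 * w v)).
    apply: ler_sum => u _; rewrite wspaceZ odeltaE modulusM modulus_of_real.
    case: eqP => [/(depth_ancestor treeE root_r) uv|_].
      rewrite modulus1 mulr1 gtr0_norm// /w uv addnC.
      rewrite -(subnK n1) addn1 addSn exprS ler_wpM2l ?invr_ge0 ?(ltW b0)//.
      by rewrite ler_wiXn2l ?invr_ge0 ?(ltW b0)// leq_addl.
    by rewrite modulus0 mulr0 mulr_ge0 ?invr_ge0 ?ltW.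
  rewrite big_const_seq count_predT iter_addr_0 -[leLHS]mulr_natl mulrA mulrC.
  rewrite ler_wpM2l ?(ltW (w0 v))// ler_pdivrMr// /b natrM mulrA.
  by rewrite mulVf ?pnatr_eq0// mul1r ler_nat.
have := Wf v vF; rewrite gE// => h; have := cw v vF => cwv.
have := ler_modulusB (of_real (w v) : K) (of_real (w v) - iter n B f v).
rewrite subKr -(modulusN (_ - iter n B f v)) opprB modulus_of_real gtr0_norm// => h1.
have := ler_modulusB (iter n B f v) (iter n B g v).
by rewrite iter_shiftB wspaceB => h2; lra.
Qed.

End Necessity.

Theorem corollary4p3 (R : realType) (k : scalar_kind) (V : countType)
    (E : rel V) (mu : weight R k V) (s : space_kind R)
    (B : {linear wspace mu s -> wspace mu s}) :
  rooted_directed_tree E ->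
  is_backward_shift E B ->
  bounded_operator B ->
  [<-> hypercyclic B;
       weakly_hypercyclic B;
       exists C : set (wspace mu s),
         [/\ bounded_set C, C `<=` ~` [set 0] & weakly_dense (Orb B C)];
       forall (g : wspace mu s) (U W : set (wspace mu s)),
         open_nbhs g U -> weakly_open_nbhs g W ->
         exists2 n : nat, (1 <= n)%N & (iter n B @` U) `&` W !=set0].
Proof.
move=> [treeE [r root_r]] shiftB boundB.
have [M M1 normB] := shift_norm_bound boundB.
tfae.
- move=> [x dx]; exists x => O O0 /weakly_open_open oO; exact: dx.
- move=> [x dx]; exists [set x]; split.
  + by exists `|x|; split=> [|c xc _ ->]; [exact: normr_real|exact: ltW].
  (* The orbit of 0 is reduced to 0, which misses the weak neighbourhood of [delta mu s r] where the
     value at [r] is within 1 of 1. *)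
  + move=> _ -> /= x0.
    have [oW Wr] := weakly_open_nbhs_coordinate [:: r] (delta mu s r) ltr01.
    have [y [Wy [n _ yn]]] := dx _ (ex_intro _ (delta mu s r) Wr) oW.
    have := Wy r (mem_head _ _); rewrite -yn x0 iter_shift0 wspace0 deltaE eqxx.
    by rewrite sub0r modulusN modulus1 ltxx.
  + move=> O O0 oO; have [y [Oy [n _ yn]]] := dx O O0 oO.
    by exists y; split=> //; exists n => //; exists x.
- move=> [C [bC _ dC]]; have shr := bounded_orb_shrinking bC dC.
  exact: (shrinking_weakly_recurrent treeE shiftB root_r M1 normB shr).
- move=> /(weakly_recurrent_shrinking treeE shiftB root_r) shr.
  exact: (shrinking_hypercyclic treeE shiftB root_r M1 normB shr).
Qed.
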